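(* Assume (H0), (H1) and $H\in C^1(\mathbb{R}^n)$. Let $(t_0,x_0)\in(0,T]\times\mathbb{R}^n$, let $y_0\in\ell(t_0,x_0)$, let $q=H^*_z\big(\frac{x_0-y_0}{t_0}\big)\in D^-\sigma(y_0)$, and let $$\mathcal{C}:\ x=x(t)=x_0+(t-t_0)H_p(q)$$ be the corresponding generalized characteristic curve of type (I) at $(t_0,x_0)$. Then $y_0\in\ell(t,x)$ for all $(t,x)\in\mathcal{C}$ with $0<t\le t_0$. Moreover, $\ell(t,x)=\{y_0\}$ for all $(t,x)\in\mathcal{C}$ with $0<t<t_0$.
   Context: Let $T>0$, $H:\mathbb{R}^n\to\mathbb{R}$, $\sigma:\mathbb{R}^n\to\mathbb{R}$. $H^*(z)=\max_{y\in\mathbb{R}^n}\{\langle z,y\rangle-H(y)\}$ is the Fenchel conjugate of $H$; $H_p$ and $H^*_z$ denote the gradients of $H$ and $H^*$ ($H^*$ is $C^1$ under (H0)). (H0): $H$ is strictly convex on $\mathbb{R}^n$ and superlinear, i.e. $\lim_{\|p\|\to\infty}H(p)/\|p\|=+\infty$. (H1): $\sigma$ is continuous on $\mathbb{R}^n$ and for every $(t_0,x_0)\in[0,T)\times\mathbb{R}^n$ there exist constants $r,N>0$ such that $\min_{\|y\|\le N}\{\sigma(y)+tH^*(\frac{x-y}{t})\}<\sigma(z)+tH^*(\frac{x-z}{t})$ whenever $\|z\|>N$, $t\in(0,T)$ and $|t-t_0|+\|x-x_0\|<r$. For $(t,x)\in(0,T]\times\mathbb{R}^n$, $\ell(t,x)$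 is the set of global minimizers over $y\in\mathbb{R}^n$ of $y\mapsto\sigma(y)+tH^*(\frac{x-y}{t})$. The subdifferential is $D^-\sigma(y)=\{p:\liminf_{h\to0}\frac{\sigma(y+h)-\sigma(y)-\langle p,h\rangle}{|h|}\ge0\}$ and the superdifferential is $D^+\sigma(y)=\{p:\limsup_{h\to0}\frac{\sigma(y+h)-\sigma(y)-\langle p,h\rangle}{|h|}\le0\}$; $D^\#\sigma(y)=D^+\sigma(y)\cup D^-\sigma(y)$ if nonempty, and $\{0\}$ otherwise. A generalized characteristic is a curve $x(t)=y+tH_p(q)$, $t\in[0,T]$, with $q\in D^\#\sigma(y)$; if it passes through $(t_0,x_0)$, it is of type (I) at $(t_0,x_0)$ when $y\in\ell(t_0,x_0)$. (For $y_0\in\ell(t_0,x_0)$ one has $H^*_z(\frac{x_0-y_0}{t_0})\in D^-\sigma(y_0)$, and the curve $\mathcal{C}$ starts at $(0,y_0)$.) Here $(t,x)\in\mathcal{C}$ means $x=x_0+(t-t_0)H_p(q)$. *)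

(* Defs.v *)
From HB Require Import structures.
From mathcomp Require Import all_boot all_order all_algebra.
From mathcomp Require Import all_classical all_reals all_analysis.
Set Implicit Arguments.
Unset Strict Implicit.
Unset Printing Implicit Defensive.
Import Order.TTheory GRing.Theory Num.Theory.
Import numFieldNormedType.Exports.
Local Open Scope classical_set_scope.
Local Open Scope ring_scope.

Section Definitions.
Context {R : realType} {n : nat}.
Implicit Types (H sigma f : 'rV[R]_n -> R) (p q x y z h : 'rV[R]_n).
Implicit Types (T t : R).

Definition dotp x y : R := \sum_(i < n) x 0 i * y 0 i.

(* The library norm `|x| on row vectors is the sup norm, hence this one;
   both norms induce the same topology. *)
Definition enorm x : R := Num.sqrt (dotp x x).

Definition grad f x : 'rV[R]_n := \row_(i < n) 'D_(delta_mx 0 i) f x.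

Definition C1 f : Prop := (forall x, differentiable f x) /\ continuous (grad f).

Definition strictly_convex f : Prop :=
  forall x y (s : R), x != y -> 0 < s < 1 ->
    f (s *: x + (1 - s) *: y) < s * f x + (1 - s) * f y.

Definition superlinear f : Prop :=
  forall M : R, exists K : R, forall p, K < enorm p -> M < f p / enorm p.

Definition hypH0 H : Prop := strictly_convex H /\ superlinear H.

(* For H strictly convex (hence continuous) and superlinear, the supremum is a
   maximum; [sup] has a meaningless value only when the set is unbounded. *)
Definition fenchel H z : R := sup [set dotp z y - H y | y in [set: 'rV[R]_n]].

Definition hopf_lax H sigma t x y : R :=
  sigma y + t * fenchel H (t^-1 *: (x - y)).

Definition ell H sigma t x : set 'rV[R]_n :=
  [set y | forall z, hopf_lax H sigma t x y <= hopf_lax H sigma t x z].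

Definition is_min (A : set R) (m : R) : Prop := A m /\ lbound A m.

Definition hypH1 T H sigma : Prop :=
  continuous sigma /\
  forall t0 x0, 0 <= t0 < T ->
    exists r N : R, [/\ 0 < r, 0 < N &
      forall t x z, N < enorm z -> 0 < t < T ->
        `|t - t0| + enorm (x - x0) < r ->
        exists2 m : R,
          is_min [set hopf_lax H sigma t x y | y in [set y | enorm y <= N]] m &
          m < hopf_lax H sigma t x z].

Definition diff_quotient sigma y p h : \bar R :=
  ((sigma (y + h) - sigma y - dotp p h) / enorm h)%:E.

(* The punctured neighbourhoods of 0. *)
Definition dnbhs0 : set_system 'rV[R]_n := (0 : 'rV[R]_n)^'.

Definition subdiff sigma y : set 'rV[R]_n :=
  [set p | (0%:E <= limf_einf (diff_quotient sigma y p) dnbhs0)%E].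

Definition superdiff sigma y : set 'rV[R]_n :=
  [set p | (limf_esup (diff_quotient sigma y p) dnbhs0 <= 0%:E)%E].

Definition sharpdiff sigma y : set 'rV[R]_n :=
  if `[< (superdiff sigma y `|` subdiff sigma y) !=set0 >]
  then superdiff sigma y `|` subdiff sigma y
  else [set 0].

Definition gen_characteristic T H sigma y q (c : R -> 'rV[R]_n) : Prop :=
  sharpdiff sigma y q /\ forall t, 0 <= t <= T -> c t = y + t *: grad H q.

Definition gen_characteristic_typeI T H sigma t0 x0 y q (c : R -> 'rV[R]_n) :
    Prop :=
  [/\ gen_characteristic T H sigma y q c, c t0 = x0 & ell H sigma t0 x0 y].

End Definitions.

(* Main.v *)
Require Import Defs.
From HB Require Import structures.
From mathcomp Require Import all_boot all_order all_algebra.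
From mathcomp Require Import all_classical all_reals all_analysis.
From mathcomp Require Import ring lra.
Import Order.TTheory GRing.Theory Num.Theory.
Import numFieldNormedType.Exports.
Local Open Scope classical_set_scope.
Local Open Scope ring_scope.

(** Write L for the Fenchel conjugate of H, z = (x0 - y0) / t0 and q for the
    gradient of L at z.

    The gradients of H and L are inverse to each other.  Superlinearity makes
    the supremum defining L a maximum ([conjugate_exists]); call p conjugate to
    z when it is attained there.  At a maximizer the gradient of H is z
    ([grad_conjugate]).  Since H is strictly convex, H - <z, .> grows at least
    linearly away from p ([conjugate_gap]), so the points conjugate to z + k
    tend to p as k tends to 0, and L is differentiable at z with gradient p
    ([fenchel_first_order], [grad_fenchel]).  Hence grad H q = z, and the curve
    C is the segment y0 + t z from y0 at time 0 to x0 at time t0.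

    That y0 minimizes the Hopf-Lax functional at (t0, x0) bounds sigma near y0
    from below by a function with gradient q at y0, so q is a subgradient of
    sigma ([subdiff_ell]).

    For 0 < t < t0, x = C t and a competitor y, the velocity (x0 - y) / t0 is
    the convex combination of w = (x - y) / t and z with weights t / t0 and
    1 - t / t0.  Convexity of L then says that going from y to x and from there
    to x0 along C costs at least as much as going from y to x0 directly, while
    for y = y0 the two costs agree: minimality of y0 at (t0, x0) passes to
    (t, x) ([hopf_lax_lt_before]).  If y differs from y0 then w differs from z,
    and the comparison is strict because differentiability of H makes L
    strictly convex ([strictly_convex_fenchel]). *)

(** * Inner product, norms and first-order expansions *)

Section RowVectors.
Set Implicit Arguments.
Unset Strict Implicit.
Context {R : realType} {n : nat}.
Implicit Types (f : 'rV[R]_n -> R) (a p x y z : 'rV[R]_n) (s e : R).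

Lemma dotpC x y : dotp x y = dotp y x.
Proof. by apply: eq_bigr => i _; rewrite mulrC. Qed.

Lemma dotpDr z x y : dotp z (x + y) = dotp z x + dotp z y.
Proof. by rewrite -big_split; apply: eq_bigr => i _; rewrite mxE mulrDr. Qed.

Lemma dotpZr z s x : dotp z (s *: x) = s * dotp z x.
Proof. by rewrite mulr_sumr; apply: eq_bigr => i _; rewrite mxE mulrCA. Qed.

Lemma dotpBr z x y : dotp z (x - y) = dotp z x - dotp z y.
Proof. by rewrite dotpDr -scaleN1r dotpZr mulN1r. Qed.

Lemma dotpDl x y z : dotp (x + y) z = dotp x z + dotp y z.
Proof. by rewrite dotpC dotpDr !(dotpC z). Qed.

Lemma dotpZl s x z : dotp (s *: x) z = s * dotp x z.
Proof. by rewrite dotpC dotpZr dotpC. Qed.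

Lemma dotp_delta z (i : 'I_n) : dotp z (delta_mx 0 i) = z 0 i.
Proof.
rewrite /dotp (bigD1 i)//= mxE !eqxx mulr1 big1 ?addr0// => j ji.
by rewrite mxE (negbTE ji) mulr0.
Qed.

Lemma coord_le_norm x (i : 'I_n) : `|x 0 i| <= `|x|.
Proof.
rewrite [leRHS]/Num.norm /= mx_normrE.
by apply/bigmax_geP; right; exists (0, i).
Qed.

Lemma norm_delta_le1 (i : 'I_n) : `|delta_mx 0 i : 'rV[R]_n| <= 1.
Proof.
rewrite -[`|_|]/(mx_norm _) mx_normrE; apply/bigmax_leP; split => // j _.
by rewrite mxE; case: (_ && _); rewrite ?normr1 ?normr0.
Qed.

Lemma dotp_le_norm x y : dotp x y <= n%:R * (`|x| * `|y|).
Proof.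
rewrite mulr_natl -[n in _ *+ n]card_ord -sumr_const.
apply: ler_sum => i _; apply: le_trans (ler_norm _) _.
by rewrite normrM ler_pM// coord_le_norm.
Qed.

Lemma norm_le_enorm x : `|x| <= enorm x.
Proof.
rewrite -[`|_|]/(mx_norm _) mx_normrE; apply/bigmax_leP; split => [|[i j] _].
  exact: sqrtr_ge0.
rewrite /= ord1 -sqrtr_sqr ler_wsqrtr// /dotp (bigD1 j)//= -expr2 lerDl.
by apply: sumr_ge0 => k _; rewrite -expr2 sqr_ge0.
Qed.

Lemma continuous_dotp z : continuous (dotp z).
Proof.
move=> x; rewrite /dotp; apply: (@cvg_big _ _ _ _ _ _ _ (nbhs x)) => [|i _].
  exact: add_continuous.
apply: cvgM; first exact: cvg_cst.
exact: coord_continuous.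
Qed.

(** Closed balls and spheres, for [A] the set of r <= e or of r = e, in one
    statement. *)
Lemma attains_min_on_norm_levels f a (A : set R) (M : R) :
    continuous f -> closed A -> (forall r, A r -> r <= M) ->
    [set x | A `|x - a|] !=set0 ->
  exists2 c, A `|c - a| & forall x, A `|x - a| -> f c <= f x.
Proof.
move=> cf clA AM A0.
have cn : continuous (fun x => `|x - a|).
  move=> x; apply: (@continuous_comp _ _ _ (fun x => x - a) Num.norm).
    exact: (@cvgB _ _ _ (nbhs x) _ id (cst a) x a cvg_id (cvg_cst _)).
  exact: norm_continuous.
have cpt : compact [set x | A `|x - a|].
  apply: bounded_closed_compact; last first.
    by apply: (preimage_closed _ clA) => x _; exact: cn.
  exists (M + `|a|); split; first exact: num_real.
  move=> N MN x /= /AM xM; rewrite -(subrK a x) (le_trans (ler_normD _ _))//.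
  by rewrite (le_trans _ (ltW MN))// lerD2r.
have [|c cA cm] := EVT_min_rV A0 cpt (f := f).
  exact: continuous_subspaceT.
by exists c => [|x xA]; [rewrite inE in cA | apply: cm; rewrite inE].
Qed.

(** Outside a ball of radius at least K and |f 0| the values of f exceed f 0, so
    the minimum over the compact ball is global. *)
Lemma coercive_attains_min f (K : R) :
    continuous f -> (forall x, K < `|x| -> `|x| <= f x) ->
  exists c, forall x, f c <= f x.
Proof.
move=> cf coer; pose r := Num.max `|K| `|f 0|.
have [||| c _ cm] := @attains_min_on_norm_levels f 0 [set s | s <= r] r cf.
- exact: closed_le.
- by [].
- by exists 0; rewrite /= subr0 normr0 le_max normr_ge0.
have c0 : f c <= f 0 by apply: cm; rewrite /= subr0 normr0 le_max normr_ge0.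
exists c => x; have [xr|rx] := leP `|x| r; first by apply: cm; rewrite /= subr0.
apply: (le_trans c0); apply: le_trans (ler_norm _) _.
have [Kx fx] : K < `|x| /\ `|f 0| < `|x|.
  by move: rx; rewrite gt_max => /andP[/(le_lt_trans (ler_norm _))].
exact: le_trans (ltW fx) (coer _ Kx).
Qed.

Lemma grad_of_first_order f z p :
    (forall e, 0 < e -> exists2 d, 0 < d &
       forall k, `|k| < d -> `|f (z + k) - f z - dotp p k| <= e * `|k|) ->
  grad f z = p.
Proof.
move=> fo; apply/rowP => i; rewrite mxE; apply: cvg_lim => //.
apply/cvgrPdist_le => e e0; have [d d0 dP] := fo _ e0.
exists d => //= h /=; rewrite sub0r normrN => hd h0.
have hi : `|h *: delta_mx 0 i : 'rV[R]_n| <= `|h|.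
  by rewrite normrZ ler_piMr// norm_delta_le1.
have /= := dP _ (le_lt_trans hi hd); rewrite dotpZr dotp_delta => Hk.
rewrite distrC -[X in _ - X](mulKf h0) /= [_ + z]addrC.
rewrite -[_ *: _]/(_ * _) -mulrBr normrM normfV ler_pdivrMl ?normr_gt0//.
by apply: le_trans Hk _; rewrite [leRHS]mulrC ler_wpM2l// ltW.
Qed.

(** The error is measured in the sup norm, which is below the Euclidean norm in
    the denominator of the difference quotients. *)
Lemma subdiff_of_first_order_lower_bound f y p :
    (forall e, 0 < e -> exists2 d, 0 < d &
       forall h, `|h| < d -> - (e * `|h|) <= f (y + h) - f y - dotp p h) ->
  subdiff f y p.
Proof.
move=> lo; rewrite /subdiff /= limf_einfE; apply/lee_addgt0Pr => e e0.
have [d d0 dP] := lo _ e0.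
rewrite -leeBlDr// add0e; apply: le_ereal_sup_tmp.
have near0 : nbhs (0 : 'rV[R]_n) [set h | `|h| < d].
  apply: (@nbhs_normP _ 'rV[R]_n _ _).2; exists d => //= h /=.
  by rewrite sub0r normrN.
exists (ereal_inf (diff_quotient f y p @` [set h | `|h| < d /\ h != 0])).
  exists [set h | `|h| < d /\ h != 0] => //.
  exact: (@filterS _ (nbhs (0 : 'rV[R]_n)) _ _ _ _ near0).
apply: le_ereal_inf_tmp => _ [h [hd h0] <-]; rewrite /diff_quotient lee_fin.
have nh : 0 < enorm h.
  by apply: lt_le_trans (norm_le_enorm h); rewrite normr_gt0.
rewrite ler_pdivlMr//; apply: le_trans (dP _ hd); rewrite mulNr lerN2.
by apply: ler_wpM2l; [exact: ltW | exact: norm_le_enorm].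
Qed.

End RowVectors.

(** * Conjugate points and differentiability of the Fenchel conjugate *)

Section Conjugate.
Set Implicit Arguments.
Unset Strict Implicit.
Context {R : realType} {n : nat}.
Context (H : 'rV[R]_n -> R).
Implicit Types (p q x y z k : 'rV[R]_n) (s e : R).

(** The point p attains the supremum defining [fenchel H z]; for convex H this
    says that z is a subgradient of H at p. *)
Definition conjugate_at z p := forall p', dotp z p' - H p' <= dotp z p - H p.

Lemma fenchel_conjugate z p : conjugate_at z p -> fenchel H z = dotp z p - H p.
Proof.
move=> zp; apply/eqP; rewrite eq_le; apply/andP; split.
  by apply: ge_sup => [|_ [p' _ <-]]; [exists (dotp z p - H p), p | exact: zp].
apply: ub_le_sup; last by exists p.
by exists (dotp z p - H p) => _ [p' _ <-]; exact: zp.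
Qed.

(** A conjugate point is required because it bounds the set whose supremum is
    [fenchel H z]. *)
Lemma fenchel_young z p' :
  (exists p, conjugate_at z p) -> dotp z p' - H p' <= fenchel H z.
Proof. by case=> p zp; rewrite (fenchel_conjugate zp). Qed.

Lemma conjugate_of_fenchel_young_eq z p :
    (exists p, conjugate_at z p) -> fenchel H z <= dotp z p - H p ->
  conjugate_at z p.
Proof. by move=> zP le p'; apply: le_trans le; exact: fenchel_young. Qed.

(** By superlinearity, with a slope larger by 1 than a bound of the functional
    <z, .>, the function H - <z, .> is coercive. *)
Lemma conjugate_exists :
  continuous H -> superlinear H -> forall z, exists p, conjugate_at z p.
Proof.
move=> cH sH z; have [K KP] := sH (n%:R * `|z| + 1).
have [||p pm] := @coercive_attains_min R n (fun p => H p - dotp z p) `|K|.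
- move=> p; apply: (@cvgB _ _ _ (nbhs p)); first exact: cH.
  exact: continuous_dotp.
- move=> p Kp; have pe := norm_le_enorm p.
  have np : 0 < enorm p by apply: lt_le_trans pe; apply: le_lt_trans Kp.
  have /KP : K < enorm p.
    by apply: le_lt_trans (ler_norm _) _; exact: lt_le_trans pe.
  rewrite ltr_pdivlMr// => Hp; rewrite lerBrDl; apply: le_trans (ltW Hp).
  rewrite mulrDl mul1r; apply: lerD => //; apply: le_trans (dotp_le_norm _ _) _.
  by rewrite mulrA; apply: ler_wpM2l => //; rewrite mulr_ge0.
- by exists p => p'; move: (pm p') => /=; lra.
Qed.

(** Fermat's rule: p minimizes H - <z, .>, so the difference quotients of H at
    p along the i-th axis are at least z_i for positive steps and at most z_i
    for negative ones. *)
Lemma grad_conjugate z p :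
  differentiable H p -> conjugate_at z p -> grad H p = z.
Proof.
move=> dH zp; apply/rowP => i; rewrite mxE; set l := derive _ _ _.
have /cvgrPdist_le cl : h^-1 *: (H (h *: delta_mx 0 i + p) - H p)
    @[h --> 0^'] --> l by apply: diff_derivable.
have quot e : 0 < e -> exists2 d, 0 < d &
    `|l - d^-1 * (H (d *: delta_mx 0 i + p) - H p)| <= e /\
    `|l - (- d)^-1 * (H (- d *: delta_mx 0 i + p) - H p)| <= e.
  move=> /cl[d /= d0 dP]; exists (d / 2); first by rewrite divr_gt0.
  have dd : `|d / 2| < d by rewrite gtr0_norm ?divr_gt0//; lra.
  split; apply: dP; rewrite /= ?sub0r ?normrN// ?oppr_eq0 gt_eqF ?divr_gt0//.
have above d : d * z 0 i <= H (d *: delta_mx 0 i + p) - H p.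
  by have := zp (d *: delta_mx 0 i + p); rewrite dotpDr dotpZr dotp_delta; lra.
apply/eqP; rewrite eq_le; apply/andP; split; apply/ler_addgt0Pr => e /quot.
- case=> d d0 [_]; rewrite ler_norml => /andP[_ le].
  have := above (- d); rewrite mulNr -mulrN -ler_pdivlMl//.
  by move: le; rewrite invrN mulNr; lra.
- case=> d d0 []; rewrite ler_norml => /andP[le _] _.
  have := above d; rewrite -ler_pdivlMl //; lra.
Qed.

(** Equality in the convexity inequality makes the point p conjugate to
    s z + (1 - s) w conjugate to both z and w, and then z = grad H p = w. *)
Lemma strictly_convex_fenchel :
    (forall z, exists p, conjugate_at z p) -> (forall p, differentiable H p) ->
  strictly_convex (fenchel H).
Proof.
move=> ex dH z w s zw /andP[s0 s1].
have [p cp] := ex (s *: z + (1 - s) *: w).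
rewrite (fenchel_conjugate cp) dotpDl !dotpZl.
have zp := fenchel_young p (ex z); have wp := fenchel_young p (ex w).
rewrite ltNge; apply/negP => ge; move/eqP: zw; apply.
have s1' : 0 < 1 - s by lra.
have zs : s * (dotp z p - H p) <= s * fenchel H z by rewrite ler_pM2l.
have ws : (1 - s) * (dotp w p - H p) <= (1 - s) * fenchel H w.
  by rewrite ler_pM2l.
have cz : conjugate_at z p.
  by apply: conjugate_of_fenchel_young_eq => //; rewrite -(ler_pM2l s0); lra.
have cw : conjugate_at w p.
  by apply: conjugate_of_fenchel_young_eq => //; rewrite -(ler_pM2l s1'); lra.
by rewrite -(grad_conjugate (dH p) cz) (grad_conjugate (dH p) cw).
Qed.

Context (cH : continuous H) (scH : strictly_convex H).

(** Let g be H - <z, .> minus its minimal value, attained at p only.  On the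
    sphere of radius e about p, g has a positive minimum by compactness; along
    rays from p, convexity makes g grow at least in proportion to the
    distance. *)
Lemma conjugate_gap z p e : conjugate_at z p -> 0 < e ->
  exists2 m, 0 < m &
    forall x, e <= `|x - p| ->
      m * `|x - p| <= (dotp z p - H p) - (dotp z x - H x).
Proof.
move=> zp e0; set g := fun x => (dotp z p - H p) - (dotp z x - H x).
have g_ge0 x : 0 <= g x by rewrite subr_ge0.
have g_chord x s : x != p -> 0 < s < 1 -> g (s *: x + (1 - s) *: p) < s * g x.
  by move=> xp s01; have := scH xp s01; rewrite /g dotpDr !dotpZr; lra.
have g_gt0 x : x != p -> 0 < g x.
  move=> xp; have half : 0 < (2^-1 : R) < 1 by lra.
  have := g_chord x _ xp half; have := g_ge0 (2^-1 *: x + (1 - 2^-1) *: p).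
  lra.
have cg : continuous g.
  move=> x; apply: (@cvgB _ _ _ (nbhs x)); first exact: cvg_cst.
  by apply: (@cvgB _ _ _ (nbhs x)); [exact: continuous_dotp | exact: cH].
(* Slide x towards p until it meets the sphere. *)
have pull x : e <= `|x - p| ->
    exists2 y, `|y - p| = e & g y * `|x - p| <= e * g x.
  move=> ex; have xp0 : 0 < `|x - p| by exact: lt_le_trans ex.
  have xp : x != p by rewrite -subr_eq0 -normr_gt0.
  move: ex; rewrite le_eqVlt => /orP[/eqP ex|ex].
    by exists x; rewrite // ex mulrC.
  pose s := e / `|x - p|.
  have s01 : 0 < s < 1 by rewrite divr_gt0//= ltr_pdivrMr// mul1r.
  exists (s *: x + (1 - s) *: p).
    rewrite scalerBl scale1r addrCA addrAC subrr add0r -scalerBr normrZ.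
    by rewrite gtr0_norm ?divfK ?gt_eqF//; case/andP: s01.
  rewrite -ler_pdivlMr// mulrAC; exact/ltW/g_chord.
(* The sphere is empty when n = 0. *)
have [S0|S0] := pselect ([set x | `|x - p| = e] !=set0); last first.
  by exists 1 => // x /pull[y ye _]; case: S0; exists y.
have [||c ce cm] :=
  attains_min_on_norm_levels (A := [set e]) (M := e) cg _ _ S0.
- exact: closed_eq.
- by move=> r ->.
have cp : c != p by rewrite -subr_eq0 -normr_gt0 ce.
exists (g c / e) => [|x /pull[y ye yx]]; first by rewrite divr_gt0// g_gt0.
rewrite mulrAC ler_pdivrMr// [leRHS]mulrC; apply: le_trans yx.
by rewrite ler_wpM2r// cm.
Qed.

(** With p' conjugate to z + k and g the gap of [conjugate_gap], the middle term
    is <k, p' - p> - g p'.  For p' near p it is at most of order |p' - p| |k|;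
    for p' far from p the gap outweighs <k, p' - p> once k is small. *)
Lemma fenchel_first_order z p e :
    (forall w, exists q, conjugate_at w q) -> conjugate_at z p -> 0 < e ->
  exists2 d, 0 < d &
    forall k, `|k| < d ->
      0 <= fenchel H (z + k) - fenchel H z - dotp p k <= e * `|k|.
Proof.
move=> ex zp e0; have n1 : 0 < n%:R + 1 :> R by rewrite ltr_wpDl.
have [m m0 gap] := conjugate_gap zp (divr_gt0 e0 n1).
(* The radius e / (n + 1) for the gap and this d absorb n, which bounds
   <k, v> against |k| |v| in the sup norm; n + 1 is positive also for n = 0. *)
exists (m / (n%:R + 1)) => [|k kd]; first exact: divr_gt0.
have [p' cp'] := ex (z + k).
have kp := cp' p; have gap' := gap p'; have kpp := dotp_le_norm k (p' - p).
have zp' := zp p'.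
rewrite (fenchel_conjugate cp') (fenchel_conjugate zp).
rewrite !dotpDl dotpBr !(dotpC k) in kp kpp *; apply/andP; split; first lra.
have k0 := normr_ge0 k; have r0 := normr_ge0 (p' - p).
move: kd gap'; rewrite ltr_pdivlMr//; have [far|near] := leP _ `|p' - p|.
  move=> kd /(_ isT) gap'.
  have : `|k| * (n%:R + 1) * `|p' - p| <= m * `|p' - p|.
    by rewrite ler_wpM2r// ltW.
  have : 0 <= e * `|k| by rewrite mulr_ge0// ltW.
  have : 0 <= `|k| * `|p' - p| by rewrite mulr_ge0.
  lra.
move=> _ _; move: near; rewrite ltr_pdivlMr// => near.
have : `|k| * (`|p' - p| * (n%:R + 1)) <= `|k| * e by rewrite ler_wpM2l// ltW.
have : 0 <= `|k| * `|p' - p| by rewrite mulr_ge0.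
lra.
Qed.

Lemma grad_fenchel z p :
  (forall w, exists q, conjugate_at w q) -> conjugate_at z p ->
  grad (fenchel H) z = p.
Proof.
move=> ex zp; apply: grad_of_first_order => e e0.
have [d d0 dP] := fenchel_first_order ex zp e0.
by exists d => // k /dP /andP[lo hi]; rewrite ger0_norm.
Qed.

End Conjugate.

(** * Minimizers of the Hopf-Lax functional along the characteristic *)

Section HopfLax.
Context {R : realType} {n : nat}.
Set Implicit Arguments.
Unset Strict Implicit.
Implicit Types (H sigma : 'rV[R]_n -> R) (x y z : 'rV[R]_n) (t : R).

(** The segments from y to x and from x to x0 have the distinct velocities w
    and z when y differs from y0, so by strict convexity they cost more together
    than the direct segment from y to x0; the segment from y0 to x0 passes
    through x, and splitting it there leaves its cost unchanged. *)
Lemma hopf_lax_lt_before H sigma t0 x0 y0 t x y :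
    strictly_convex (fenchel H) -> ell H sigma t0 x0 y0 ->
    0 < t < t0 -> x = y0 + t *: (t0^-1 *: (x0 - y0)) -> y != y0 ->
  hopf_lax H sigma t x y0 < hopf_lax H sigma t x y.
Proof.
move=> scL y0min /andP[t_gt0 tt0] + yy0; set z := t0^-1 *: _ => xE.
have t0_gt0 := lt_trans t_gt0 tt0.
have [t_neq0 t0_neq0] : t != 0 /\ t0 != 0 by rewrite !gt_eqF.
set w := t^-1 *: (x - y).
have zE : t^-1 *: (x - y0) = z.
  by rewrite xE addrC addKr scalerA mulVf// scale1r.
have wz : w != z.
  rewrite -zE; apply: contra_neq yy0.
  by move=> /(scalerI (invr_neq0 t_neq0))/addrI/oppr_inj.
have mid : t0^-1 *: (x0 - y) = (t / t0) *: w + (1 - t / t0) *: z.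
  by apply/rowP => i; rewrite /w xE /z !mxE; field; rewrite t_neq0 t0_neq0.
have s01 : 0 < t / t0 < 1 by rewrite divr_gt0//= ltr_pdivrMr// mul1r.
have := scL _ _ _ wz s01; rewrite -(ltr_pM2l t0_gt0) -mid.
rewrite mulrDr [t0 * (t / t0 * _)]mulrA [t0 * ((1 - _) * _)]mulrA.
have -> : t0 * (t / t0) = t by field.
have -> : t0 * (1 - t / t0) = t0 - t by field.
have := y0min y; rewrite /hopf_lax -/z -/w zE; lra.
Qed.

(** Comparing y0 with y0 + h at (t0, x0) gives
    sigma (y0 + h) - sigma y0 >= t0 (L z - L (z - h / t0)), so an upper
    first-order bound on L at z becomes a lower one on sigma at y0. *)
Lemma subdiff_ell H sigma t0 x0 y0 p :
    0 < t0 -> ell H sigma t0 x0 y0 ->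
    let z := t0^-1 *: (x0 - y0) in
    (forall e, 0 < e -> exists2 d, 0 < d & forall k, `|k| < d ->
       fenchel H (z + k) - fenchel H z - dotp p k <= e * `|k|) ->
  subdiff sigma y0 p.
Proof.
move=> t0_gt0 y0min z fo.
apply: subdiff_of_first_order_lower_bound => e /fo[d d0 dP].
exists (t0 * d) => [|h hd]; first exact: mulr_gt0.
have := dP (- (t0^-1 *: h)); rewrite normrN normrZ gtr0_norm ?invr_gt0//.
rewrite ltr_pdivrMl// => /(_ hd).
have -> : z - t0^-1 *: h = t0^-1 *: (x0 - (y0 + h)).
  by rewrite -scalerBr opprD addrA.
rewrite -scaleNr dotpZr -(ler_pM2l t0_gt0) !mulrBr !mulrA.
rewrite [t0 * e]mulrC -!mulrA mulNr mulrN !(mulrA t0) mulfV ?gt_eqF// !mul1r.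
have := y0min (y0 + h); rewrite /hopf_lax -/z; lra.
Qed.

End HopfLax.

(** * Propagation of minimizers *)

Theorem theorem3p6 (R : realType) (n : nat) (T : R) (H sigma : 'rV[R]_n -> R)
    (t0 : R) (x0 y0 : 'rV[R]_n)
    (T_gt0 : 0 < T) (H_H0 : hypH0 H) (sigma_H1 : hypH1 T H sigma) (H_C1 : C1 H)
    (t0_in : 0 < t0 <= T) (y0_ell : ell H sigma t0 x0 y0) :
  let q := grad (fenchel H) (t0^-1 *: (x0 - y0)) in
  let C := fun t : R => x0 + (t - t0) *: grad H q in
  [/\ subdiff sigma y0 q,
      gen_characteristic_typeI T H sigma t0 x0 y0 q C,
      forall (t : R) (x : 'rV[R]_n), x = C t -> 0 < t <= t0 ->
        ell H sigma t x y0 &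
      forall (t : R) (x : 'rV[R]_n), x = C t -> 0 < t < t0 ->
        ell H sigma t x = [set y0] ].
Proof.
have [scH sH] := H_H0; have [dH _] := H_C1; have [t0_gt0 _] := andP t0_in.
have cH : continuous H by move=> p; exact: differentiable_continuous.
have ex := conjugate_exists cH sH.
have scL := strictly_convex_fenchel ex dH.
move=> q C; set z := t0^-1 *: (x0 - y0) in q C *.
have [p zp] := ex z.
have qp : q = p by exact: grad_fenchel.
have gradq : grad H q = z by rewrite qp; exact: grad_conjugate.
have Cy0 t : C t = y0 + t *: z.
  by rewrite /C gradq /z; apply/rowP => i; rewrite !mxE; field; rewrite gt_eqF.
have sub_q : subdiff sigma y0 q.
  apply: (subdiff_ell t0_gt0 y0_ell) => e e0; rewrite qp.
  have [d d0 dP] := fenchel_first_order cH scH ex zp e0.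
  by exists d => // k /dP /andP[].
have Ct0 : C t0 = x0 by rewrite /C subrr scale0r addr0.
have lt_before t y : 0 < t < t0 -> y != y0 ->
    hopf_lax H sigma t (C t) y0 < hopf_lax H sigma t (C t) y.
  by move=> tt0; exact: hopf_lax_lt_before scL y0_ell tt0 (Cy0 t).
have ell_before t : 0 < t < t0 -> ell H sigma t (C t) y0.
  by move=> tt0 y; have [->//|/(lt_before _ _ tt0)/ltW] := eqVneq y y0.
split => //.
- split => //; split; last by move=> t _; rewrite Cy0 gradq.
  have q_sharp : (superdiff sigma y0 `|` subdiff sigma y0) q by right.
  by rewrite /sharpdiff asboolT//; exists q.
- move=> t x -> /andP[t_gt0]; rewrite le_eqVlt => /orP[/eqP ->|tt0].
    by rewrite Ct0.
  by apply: ell_before; rewrite t_gt0.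
- move=> t x -> tt0; apply/seteqP; split=> [y ymin|_ ->]; last first.
    exact: ell_before.
  apply/eqP; apply: contraT => /(lt_before _ _ tt0).
  by rewrite ltNge ymin.
Qed.
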